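(* Assume the following (all notation is as defined in the context). The functions $f,h,l$ are proper lower semicontinuous convex, $f$ is Fréchet differentiable, and $l$ is strictly convex in the sense that its conjugate $l^*$ is Fréchet differentiable; the operators $\mathbf P$ and $\mathbf M_1$ are positive definite; the iteration (I) has at least one fixed point; and there are constants $\beta>0$, $\mu_f\ge0$, $\mu_h\ge0$, $\mu_l\ge0$ such that for any fixed point $(\mathbf x^\star,\mathbf s^\star)$ of (I), any $\mathbf x\in\mathcal X$ and any $\mathbf s\in\mathcal S$, $$\langle \mathbf x-\mathbf x^\star,\nabla f(\mathbf x)-\nabla f(\mathbf x^\star)\rangle\ge\beta\|\nabla f(\mathbf x)-\nabla f(\mathbf x^\star)\|^2_{\mathbf P^{-1}},$$ $$\langle \mathbf s-\mathbf s^\star,\nabla l^*(\mathbf s)-\nabla l^*(\mathbf s^\star)\rangle\ge\beta\|\nabla l^*(\mathbf s)-\nabla l^*(\mathbf s^\star)\|^2_{\mathbf M_1^{-1}},$$ $$\langle \mathbf x-\mathbf x^\star,\nabla f(\mathbf x)-\nabla f(\mathbf x^\star)\rangle\ge\mu_f\|\mathbf x-\mathbf x^\star\|^2_{\mathbf P},$$ $$\langle \mathbf s-\mathbf s^\star,\mathbf p-\mathbf p^\star\rangle\ge\mu_h\|\mathbf s-\mathbf s^\star\|^2_{\mathbf M_1}\quad\text{for }\mathbf p\in\partial h^*(\mathbf s),\ \mathbf p^\star\in\partial h^*(\mathbf s^\star),$$ $$\langle \mathbf s-\mathbf s^\star,\nabla l^*(\mathbf s)-\nabla l^*(\mathbf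 s^\star)\rangle\ge\mu_l\|\mathbf s-\mathbf s^\star\|^2_{\mathbf M_1}.$$ Let $(\mathbf x^\star,\mathbf s^\star)$ be a fixed point of (I), and let $\{(\mathbf x^k,\mathbf s^k)\}$ be generated by (I). Define $\widehat{\mathbf M}:=(1+2\tau\mu_h)\mathbf M_1+\mathbf M_2$ and $C_1:=\|\mathbf M_1^{-1/2}\mathbf M_2\mathbf M_1^{-1/2}\|\ge0$ (operator norm). Then for every $k$, $$\|(\mathbf x^{k+1},\mathbf s^{k+1})-(\mathbf x^\star,\mathbf s^\star)\|^2_{\mathbf P,\widehat{\mathbf M}}\le\rho_1\,\|(\mathbf x^{k},\mathbf s^{k})-(\mathbf x^\star,\mathbf s^\star)\|^2_{\mathbf P,\widehat{\mathbf M}},$$ where $$\rho_1=\max\left(\frac{1-(2\tau-\tau^2/\beta)\mu_l+C_1}{1+2\tau\mu_h+C_1},\ 1-(2\tau-\tau^2/\beta)\mu_f\right).$$ The sequence $\{(\mathbf x^k,\mathbf s^k)\}$ converges linearly to the fixed point $(\mathbf x^\star,\mathbf s^\star)$ with rate $\rho_1<1$ if $\tau\in(0,2\beta)$, $\mu_h+\mu_l>0$, and $\mu_f>0$.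
   Context: $\mathcal X$ and $\mathcal S$ are real Hilbert spaces; $f:\mathcal X\to(-\infty,+\infty]$ and $h,l:\mathcal S\to(-\infty,+\infty]$; $h^*,l^*$ are the Legendre–Fenchel conjugates and $\partial h^*$ is the convex subdifferential. $\mathbf A:\mathcal X\to\mathcal S$ is a bounded linear operator with adjoint $\mathbf A^\top$. $\mathbf P$ on $\mathcal X$ and $\mathbf D$ on $\mathcal S$ are bounded self-adjoint linear operators, and $\tau,\sigma>0$, $\theta\in(3/4,1]$ are parameters. ''Positive definite'' means bounded, self-adjoint and bounded below by a positive multiple of the identity (hence boundedly invertible). Define $$\mathbf M=\tfrac{\tau}{\sigma}(\mathbf D-\tau\sigma\mathbf A\mathbf P^{-1}\mathbf A^\top),\quad \mathbf M_1=\tfrac{\tau}{\sigma}(\mathbf D-\theta\tau\sigma\mathbf A\mathbf P^{-1}\mathbf A^\top),\quad \mathbf M_2=\tau^2(1-\theta)\mathbf A\mathbf P^{-1}\mathbf A^\top,$$ so that $\mathbf M=\mathbf M_1-\mathbf M_2$ (and $\mathbf M$ need not be positive semidefinite). For a self-adjoint operator $\mathbf Q$, $\|\mathbf v\|^2_{\mathbf Q}:=\langle \mathbf v,\mathbf Q\mathbf v\rangle$, and $\|(\mathbf x,\mathbf s)\|^2_{\mathbf P,\mathbf Q}:=\|\mathbf x\|^2_{\mathbf P}+\|\mathbf s\|^2_{\mathbf Q}$. Iteration (I): given $(\mathbf x^k,\mathbf s^k)\in\mathcal X\times\mathcal S$, $$\mathbf s^{k+1}=(\mathbf D+\sigma\partial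 h^* )^{-1}\Big(\tfrac{\sigma}{\tau}\mathbf M\mathbf s^k+\sigma\mathbf A\big(\mathbf x^k-\tau\mathbf P^{-1}\nabla f(\mathbf x^k)\big)-\sigma\nabla l^*(\mathbf s^k)\Big),$$ $$\mathbf x^{k+1}=\mathbf x^k-\tau\mathbf P^{-1}\nabla f(\mathbf x^k)-\tau\mathbf P^{-1}\mathbf A^\top\mathbf s^{k+1}.$$ A fixed point of (I) is a pair $(\mathbf x^\star,\mathbf s^\star)$ that (I) maps to itself.
   Formalization: The contraction inequality for every k is proved under the added condition τ ≤ 2β, without which it is false (A = 0, P = 1, f(x) = x²/2, β = 1, all μ = 0, τ = 10 gives x^{k+1} = −9x^k but ρ₁ = 1). *)

(* Defs.v *)
From HB Require Import structures.
From mathcomp Require Import all_boot all_order all_algebra.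
From mathcomp Require Import all_classical all_reals all_analysis.

Set Implicit Arguments.
Unset Strict Implicit.
Unset Printing Implicit Defensive.

Import Order.TTheory GRing.Theory Num.Theory.
Import numFieldNormedType.Exports.

Local Open Scope classical_set_scope.
Local Open Scope ring_scope.

HB.mixin Record CompleteNormedModule_isHilbert (R : realType) H
    of CompleteNormedModule R H := {
  inner : H -> H -> R;
  innerC : forall x y, inner x y = inner y x;
  inner_linearl : forall y a x z,
    inner (a *: x + z) y = a * inner x y + inner z y;
  inner_norm : forall x, inner x x = `|x| ^+ 2
}.

#[short(type="hilbertType")]
HB.structure Definition Hilbert (R : realType) :=
  {H of CompleteNormedModule_isHilbert R H & CompleteNormedModule R H}.

Section Operators.
Context {R : realType}.

Definition bounded_operator (V W : normedModType R) (T : V -> W) : Prop :=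
  linear T /\ exists C : R, forall x, `|T x| <= C * `|x|.

Definition op_norm (V W : normedModType R) (T : V -> W) : R :=
  sup [set `|T x| | x in [set x : V | `|x| <= 1]].

(* Meaningful for bounded A, where the set is a singleton by Riesz. *)
Definition adjoint (V W : hilbertType R) (A : V -> W) (w : W) : V :=
  get [set v : V | forall x, inner (A x) w = inner x v].

Definition self_adjoint (H : hilbertType R) (Q : H -> H) : Prop :=
  forall x y, inner (Q x) y = inner x (Q y).

Definition pos_semidefinite (H : hilbertType R) (Q : H -> H) : Prop :=
  [/\ bounded_operator Q, self_adjoint Q & forall x, 0 <= inner x (Q x)].

Definition pos_definite (H : hilbertType R) (Q : H -> H) : Prop :=
  [/\ bounded_operator Q, self_adjoint Q &
      exists2 c : R, 0 < c & forall x, c * `|x| ^+ 2 <= inner x (Q x)].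

(* Meaningful for bijective Q, in particular for positive definite Q. *)
Definition op_inv (H : hilbertType R) (Q : H -> H) (y : H) : H :=
  get [set x : H | Q x = y].

(* The positive square root, which exists and is unique for positive
   semidefinite Q. *)
Definition op_sqrt (H : hilbertType R) (Q : H -> H) : H -> H :=
  get [set W : H -> H | pos_semidefinite W /\ W \o W = Q].

Definition sqnorm (H : hilbertType R) (Q : H -> H) (v : H) : R :=
  inner v (Q v).

Definition sqnorm_pair (V W : hilbertType R) (P : V -> V) (Q : W -> W)
  (z : V * W) : R := sqnorm P z.1 + sqnorm Q z.2.

End Operators.

Section ConvexAnalysis.
Context {R : realType} {H : hilbertType R}.
Implicit Types F : H -> \bar R.
Local Open Scope ereal_scope.

Definition proper F : Prop :=
  (forall x, F x != -oo) /\ exists x, F x < +oo.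

Definition econvex F : Prop :=
  forall (x y : H) (t : R), (0 <= t <= 1)%R ->
    F (t *: x + (1 - t) *: y)%R <= t%:E * F x + (1 - t)%:E * F y.

Definition proper_lsc_convex F : Prop :=
  [/\ proper F, lower_semicontinuous F & econvex F].

Definition conjugate F (s : H) : \bar R :=
  ereal_sup [set (inner s v)%:E - F v | v in [set: H]].

Definition subdifferential F (s : H) : set H :=
  [set p : H | forall v, F s + (inner p (v - s)%R)%:E <= F v].

Definition frechet_differentiable F : Prop :=
  (forall x, F x \is a fin_num) /\
  forall x, differentiable (fine \o F : H -> R) x.

(* Riesz representative of the Frechet derivative. *)
Definition gradient F (x : H) : H :=
  get [set g : H | forall v, 'd (fine \o F : H -> R) x v = inner g v].

End ConvexAnalysis.

Section Iteration.
Context {R : realType} {X S : hilbertType R}.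

(* (D + sigma G)^{-1} y for a set-valued G; the set is a singleton when D is
   positive definite and G is maximally monotone. *)
Definition resolvent (D : S -> S) (sigma : R) (G : S -> set S) (y : S) : set S :=
  [set s : S | exists2 p, G s p & D s + sigma *: p = y].

Definition opAPA (A : X -> S) (P : X -> X) : S -> S :=
  A \o op_inv P \o adjoint A.

Definition opM (P : X -> X) (D : S -> S) (A : X -> S) (tau sigma : R)
  (s : S) : S := (tau / sigma) *: (D s - (tau * sigma) *: opAPA A P s).

Definition opM1 (P : X -> X) (D : S -> S) (A : X -> S) (tau sigma theta : R)
  (s : S) : S := (tau / sigma) *: (D s - (theta * tau * sigma) *: opAPA A P s).

Definition opM2 (P : X -> X) (A : X -> S) (tau theta : R) (s : S) : S :=
  (tau ^+ 2 * (1 - theta)) *: opAPA A P s.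

(* One step of the iteration, as a relation between (x, s) and its successor. *)
Definition iter_step (f : X -> \bar R) (h l : S -> \bar R) (P : X -> X)
    (D : S -> S) (A : X -> S) (tau sigma : R) (z z' : X * S) : Prop :=
  let: (x, s) := z in
  let: (x', s') := z' in
  resolvent D sigma (subdifferential (conjugate h))
    ((sigma / tau) *: opM P D A tau sigma s
     + sigma *: A (x - tau *: op_inv P (gradient f x))
     - sigma *: gradient (conjugate l) s) s' /\
  x' = x - tau *: op_inv P (gradient f x) - tau *: op_inv P (adjoint A s').

Definition fixed_point (f : X -> \bar R) (h l : S -> \bar R) (P : X -> X)
    (D : S -> S) (A : X -> S) (tau sigma : R) (z : X * S) : Prop :=
  iter_step f h l P D A tau sigma z z.

End Iteration.

(* Main.v *)
Require Import Defs.
From mathcomp Require Import all_boot all_order all_algebra.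
From mathcomp Require Import all_classical all_reals all_analysis.
From mathcomp Require Import ring lra.

(** Write [xs], [ss] for the fixed point, [dx = x - xs], [v = s - ss] for the
    errors before a step, [dx' = x' - xs], [w = s' - ss] for those after it,
    and [g], [p], [q] for the differences of the values of the gradient of [f],
    the subdifferential of [h^*] and the gradient of [l^*].  Eliminating
    [A (x - tau P^-1 grad f x)] between the two lines of the iteration leaves
    ([step_increments])
      [dx - tau P^-1 g = dx' + tau P^-1 A^T w]  and
      [M (w - v) + tau (p + q) = tau A dx'].
    The squared [P]-norm of the first relation contains the cross term
    [2 tau <A dx', w>], which the second one rewrites through [M = M1 - M2].
    The resulting identity is then a sum of four independent estimates:
    - the primal forward step [dx - tau P^-1 g] and the dual one
      [v - tau M1^-1 q] contract, by cocoercivity and strong monotonicity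
      ([forward_step_le], used for both);
    - the [M1] part of the cross term and the backward dual step leave the
      dual forward step minus [||w||^2_M1] ([dual_forward_backward_le]);
    - the indefinite part [M2] is absorbed by [tau^2 ||w||^2] in the seminorm
      of [A P^-1 A^T], which is exactly where [theta >= 3/4] is needed
      ([indefinite_part_le]);
    - the strong monotonicity of the subdifferential supplies [2 tau mu_h].
    Together ([increment_descent]) they bound the new error by
    [a_f ||dx||^2_P + a_l ||v||^2_M1 + ||v||^2_M2], where [a_f] and [a_l] are
    [1 - (2 tau - tau^2 / beta) mu] for [mu = mu_f, mu_l].  Since
    [M2 <= C1 M1] as quadratic forms, replacing the quotient of
    [a_l ||v||^2_M1 + ||v||^2_M2] by [||v||^2_Mhat] with its largest possible
    value, attained when [||v||^2_M2 = C1 ||v||^2_M1], gives the factor [rho1]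
    ([mediant_le]).

    The operators in the statement are descriptions of objects whose existence
    has to be established on a Hilbert space: the adjoint comes from the Riesz
    theorem ([riesz_representation]), the inverse of a positive definite [Q]
    from the contraction [1 - t Q] ([op_invK]), and the square root of
    [M1^-1], needed for [M2 <= C1 M1] ([quadratic_form_le]), from the iteration
    [Y |-> (B + Y^2) / 2] with [B = 1 - t Q] ([pos_definite_sqrt]).  All three
    limits are limits of sequences with geometrically decreasing steps
    ([geometric_steps_cvg]). *)

Import Order.TTheory GRing.Theory Num.Theory.
Import numFieldNormedType.Exports.

Local Open Scope classical_set_scope.
Local Open Scope ring_scope.

Set Implicit Arguments.
Unset Strict Implicit.

(** * Inner product *)

Section Inner.
Context {R : realType} {H : hilbertType R}.
Implicit Types (x y z u v : H) (a : R).

Lemma innerDl x y z : inner (x + y) z = inner x z + inner y z.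
Proof. by have := inner_linearl z 1 x y; rewrite scale1r mul1r. Qed.

Lemma inner0l z : inner 0 z = 0.
Proof. by have := innerDl 0 0 z; rewrite addr0; lra. Qed.

Lemma innerZl a x z : inner (a *: x) z = a * inner x z.
Proof. by have := inner_linearl z a x 0; rewrite addr0 inner0l addr0. Qed.

Lemma innerNl x z : inner (- x) z = - inner x z.
Proof. by rewrite -scaleN1r innerZl mulN1r. Qed.

Lemma innerDr z x y : inner z (x + y) = inner z x + inner z y.
Proof. by rewrite innerC innerDl !(innerC z). Qed.

Lemma innerZr z a x : inner z (a *: x) = a * inner z x.
Proof. by rewrite innerC innerZl (innerC z). Qed.

Lemma innerNr z x : inner z (- x) = - inner z x.
Proof. by rewrite innerC innerNl (innerC z). Qed.

Definition innerE := (innerDl, innerDr, innerNl, innerNr, innerZl, innerZr).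

Lemma inner_ge0 x : 0 <= inner x x.
Proof. by rewrite inner_norm exprn_ge0. Qed.

Lemma inner_norm_le x y : `|inner x y| <= `|x| * `|y|.
Proof.
have [->|y0] := eqVneq y 0.
  by rewrite innerC inner0l !normr0 mulr0.
have yp : 0 < `|y| ^+ 2 by rewrite exprn_gt0 // normr_gt0.
have := inner_ge0 (`|y| ^+ 2 *: x - inner x y *: y).
rewrite !innerE !inner_norm (innerC y x) => h.
have {}h : 0 <= `|y| ^+ 2 * (`|x| ^+ 2 * `|y| ^+ 2 - inner x y ^+ 2).
  by apply: le_trans h _; rewrite le_eqVlt; apply/orP; left; apply/eqP; ring.
rewrite -(@ler_pXn2r _ 2) ?nnegrE ?mulr_ge0 // exprMn.
by rewrite -normrX ger0_norm ?sqr_ge0 // -subr_ge0 -(pmulr_rge0 _ yp).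
Qed.

Lemma inner_le x y : inner x y <= `|x| * `|y|.
Proof. exact: le_trans (ler_norm _) (inner_norm_le x y). Qed.

(** Vectors are separated by their inner products, so an identity between
    linear combinations of vectors reduces, by [innerE], to one between reals
    that [ring] or [field] decides; this is how such identities are proved
    below. *)
Lemma eq_innerr u v : (forall x, inner x u = inner x v) -> u = v.
Proof.
move=> h; apply/eqP; rewrite -subr_eq0 -normr_eq0 -sqrf_eq0.
by rewrite -inner_norm innerDr innerNr h subrr.
Qed.

End Inner.

(** * Geometric sequences and bounded operators *)

Section Geometric.
Context {R : realType}.

Lemma cvg_of_norm_le {V : normedModType R} (u : nat -> V) (a : V)
    (e : nat -> R) :
  (forall n, `|u n - a| <= e n) -> e @ \oo --> 0 -> u @ \oo --> a.
Proof.
move=> ue e0; apply/subr_cvg0; apply: norm_cvg0.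
apply: (squeeze_cvgr (f := fun=> 0) (h := e)) => //; last exact: cvg_cst.
by apply: nearW => n /=; rewrite normr_ge0 ue.
Qed.

Lemma seq_cvg_unique {V : normedModType R} (u : nat -> V) (a b : V) :
  u @ \oo --> a -> u @ \oo --> b -> a = b.
Proof. exact: norm_cvg_unique. Qed.

Lemma geometric_cvg0 (K r : R) :
  0 <= r < 1 -> (fun n => K * r ^+ n) @ \oo --> 0.
Proof.
by move=> /andP[r0 r1]; apply: (@cvg_geometric _ K r); rewrite ger0_norm.
Qed.

(** The increments form an absolutely convergent series, dominated by a
    geometric one. *)
Lemma geometric_steps_cvg {V : completeNormedModType R} (u : nat -> V)
    (K r : R) :
  0 <= r < 1 -> (forall n, `|u n.+1 - u n| <= K * r ^+ n) ->
  exists a : V, u @ \oo --> a.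
Proof.
move=> /andP[r0 r1] ur.
have K0 : 0 <= K by have := le_trans (normr_ge0 _) (ur 0%N); rewrite expr0 mulr1.
have hc : cvgn (series (telescope u)).
  apply: normed_cvg; apply: (@series_le_cvg _ _ (geometric K r)) => [n|n|n|] /=.
  - exact: normr_ge0.
  - by rewrite mulr_ge0 ?exprn_ge0.
  - exact: ur.
  - by apply: is_cvg_geometric_series; rewrite ger0_norm.
exists (u 0%N + limn (series (telescope u))).
rewrite [u in u @ _ --> _](_ : _ = fun n => u 0%N + series (telescope u) n).
  by apply: cvgD => //; exact: cvg_cst.
by apply/funext => n; exact: eq_sum_telescope.
Qed.

End Geometric.

Section Linear.
Context {R : realType} {V W : normedModType R} (T : V -> W).
Hypothesis linT : linear T.

Lemma lin0 : T 0 = 0.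
Proof.
by have := linT 1 0 0; rewrite !scale1r addr0 => /esym/(canRL (addrK _)); rewrite subrr.
Qed.

Lemma linD x y : T (x + y) = T x + T y.
Proof. by have := linT 1 x y; rewrite !scale1r. Qed.

Lemma linZ a x : T (a *: x) = a *: T x.
Proof. by have := linT a x 0; rewrite !addr0 lin0 addr0. Qed.

Lemma linN x : T (- x) = - T x.
Proof. by rewrite -scaleN1r linZ scaleN1r. Qed.

Lemma linB x y : T (x - y) = T x - T y.
Proof. by rewrite linD linN. Qed.

End Linear.

(** A positive bound, as large as needed: the strict inequality [c < C] keeps
    the contraction factor of [pos_definite_damping] nonnegative, even on the
    zero space where any constant is a bound. *)
Lemma bounded_operator_bound {R : realType} {V W : normedModType R}
    (T : V -> W) (c : R) : bounded_operator T ->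
  exists C, [/\ 0 < C, c < C & forall x, `|T x| <= C * `|x|].
Proof.
case=> _ [C hC]; exists (`|C| + `|c| + 1); split.
- by have := normr_ge0 C; have := normr_ge0 c; lra.
- by have := normr_ge0 C; have := ler_norm c; lra.
- move=> x; apply: le_trans (hC x) _; apply: ler_wpM2r => //.
  by have := normr_ge0 c; have := ler_norm C; lra.
Qed.

Lemma bounded_operator_cvg {R : realType} {V W : normedModType R}
    (T : V -> W) (u : nat -> V) (a : V) : bounded_operator T ->
  u @ \oo --> a -> (T \o u) @ \oo --> T a.
Proof.
move=> bT ua; have [C [C0 _ hC]] := bounded_operator_bound 0 bT.
apply: (cvg_of_norm_le (e := fun n => C * `|u n - a|)) => [n /=|].
  by rewrite -(linB bT.1) hC.
rewrite -(mulr0 C); apply: cvgMl_tmp.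
by apply/norm_cvg0P/subr_cvg0.
Qed.

Lemma inner_cvgl {R : realType} {H : hilbertType R} (u : nat -> H) (a x : H) :
  u @ \oo --> a -> (fun n => inner (u n) x) @ \oo --> (inner a x : R^o).
Proof.
apply: (bounded_operator_cvg (T := fun y : H => inner y x : R^o)); split.
  by move=> b y z; rewrite inner_linearl.
by exists `|x| => y; rewrite mulrC; exact: inner_norm_le.
Qed.

(** * Riesz representation and adjoints *)

Lemma quadratic_ge0_discriminant {R : realFieldType} (b n e : R) :
  0 <= n -> (forall t : R, 0 <= t * b + t ^+ 2 * n / 2 + e) ->
  b ^+ 2 <= 2 * n * e.
Proof.
move=> n0 h; have [z|z] := eqVneq n 0.
  have [->|b0] := eqVneq b 0; first by rewrite z expr0n /= mulr0 mul0r.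
  by have := h (- (e + 1) / b); rewrite z mulr0 mul0r addr0 divfK //; lra.
have np : 0 < n by rewrite lt_def z.
have := h (- b / n); rewrite -(pmulr_rge0 _ np).
have -> : n * (- b / n * b + (- b / n) ^+ 2 * n / 2 + e) = - b ^+ 2 / 2 + n * e.
  by field.
lra.
Qed.

Lemma exp_quarter {R : realType} n : ((1 / 4 : R) ^+ n) = ((1 / 2) ^+ n) ^+ 2.
Proof. by rewrite -exprM mulnC exprM; congr (_ ^+ _); field. Qed.

(** The representative minimizes [J x = |x|^2 / 2 - phi x].  Since [J] is
    quadratic, a point at which [J] is within [e] of its infimum is within
    [O(sqrt e)] of any other such point, and [|<u, x> - phi x|] is at most
    [sqrt (2 e) |x|] there by the discriminant of [t |-> J (u + t x)].
    Near-minimizers with gaps [4^-n] thus have steps of order [2^-n], and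
    their limit satisfies [<a, x> = phi x]. *)
Lemma riesz_representation {R : realType} {H : hilbertType R} (phi : H -> R^o) :
  bounded_operator phi -> exists v, forall x, phi x = inner x v.
Proof.
move=> bphi; have [C [C0 _ hC]] := bounded_operator_bound 0 bphi.
have linphi := bphi.1.
pose J x := inner x x / 2 - phi x.
have Jge x : - (C ^+ 2 / 2) <= J x.
  rewrite /J inner_norm; have := le_trans (ler_norm _) (hC x).
  have := sqr_ge0 (`|x| - C); lra.
pose E := [set J x | x in [set: H]].
have infE : has_inf E.
  by split; [exists (J 0), 0 | exists (- (C ^+ 2 / 2)) => _ [x _ <-]].
have mJ x : inf E <= J x by apply: ge_inf; [case: infE | exists x].
have /choice [u hu] n : exists x, J x < inf E + (1 / 4) ^+ n.
  have e0 : 0 < (1 / 4 : R) ^+ n by rewrite exprn_gt0 //; lra.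
  by have [_ [x _ <-] hx] := inf_adherent e0 infE; exists x.
have Jq a x t : J (a + t *: x) = J a + t * (inner a x - phi x) + t ^+ 2 * inner x x / 2.
  rewrite /J (linD linphi) (linZ linphi) !innerE (innerC x a) /=.
  by rewrite /GRing.scale /=; field.
have ustep n : `|u n.+1 - u n| <= 3 * (1 / 2) ^+ n.
  have h0 : 0 <= (1 / 2 : R) ^+ n by rewrite exprn_ge0 //; lra.
  rewrite -(@ler_pXn2r _ 2) ?nnegrE ?mulr_ge0 // exprMn -exp_quarter -inner_norm.
  (* parallelogram law: compare with the value at the midpoint *)
  have hm := mJ (u n + (1 / 2) *: (u n.+1 - u n)).
  have h1 : J (u n.+1) = J (u n + 1 *: (u n.+1 - u n)) by rewrite scale1r addrC subrK.
  move: hm h1; rewrite !Jq => hm h1.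
  have := hu n; have := hu n.+1; rewrite exprS.
  have : 0 <= (1 / 4 : R) ^+ n by rewrite exprn_ge0 //; lra.
  move: hm h1; lra.
have r01 : 0 <= (1 / 2 : R) < 1 by lra.
have [a ua] := geometric_steps_cvg r01 ustep.
exists a => x; rewrite innerC.
suff hphi : (fun n => inner (u n) x) @ \oo --> (phi x : R^o).
  exact: (seq_cvg_unique (V := R^o) hphi (inner_cvgl ua)).
apply: (cvg_of_norm_le (V := R^o) (e := fun n => (2 * `|x|) * (1 / 2) ^+ n)).
  move=> n; have h0 : 0 <= (1 / 2 : R) ^+ n by rewrite exprn_ge0 //; lra.
  rewrite -(@ler_pXn2r _ 2) ?nnegrE ?mulr_ge0 // -normrX ger0_norm ?sqr_ge0 //.
  rewrite 2!exprMn -exp_quarter -inner_norm.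
  apply: le_trans (quadratic_ge0_discriminant (e := (1 / 4) ^+ n)
    (inner_ge0 x) _) _.
  - move=> t; have := mJ (u n + t *: x); rewrite Jq; have := hu n; lra.
  - have := mulr_ge0 (inner_ge0 x) (sqr_ge0 ((1 / 2) ^+ n)); rewrite exp_quarter.
    lra.
exact: geometric_cvg0.
Qed.

Lemma adjointP {R : realType} {V W : hilbertType R} (A : V -> W) :
  bounded_operator A -> forall x w, inner (A x) w = inner x (adjoint A w).
Proof.
move=> bA x w; have [C [C0 _ hC]] := bounded_operator_bound 0 bA.
suff /getPex : exists v, forall y, inner (A y) w = inner y v by apply.
apply: (riesz_representation (phi := fun y => inner (A y) w : R^o)); split.
  by move=> a y z; rewrite bA.1 !innerE.
exists (C * `|w|) => y; apply: le_trans (inner_norm_le _ _) _.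
by rewrite mulrAC ler_wpM2r.
Qed.

Lemma bounded_adjoint {R : realType} {V W : hilbertType R} (A : V -> W) :
  bounded_operator A -> bounded_operator (adjoint A).
Proof.
move=> bA; have [C [C0 _ hC]] := bounded_operator_bound 0 bA; split.
  move=> a u v; apply: eq_innerr => x.
  by rewrite -(adjointP bA) !innerE -!(adjointP bA).
exists C => w; have [->|w0] := eqVneq (adjoint A w) 0.
  by rewrite normr0 mulr_ge0 // ltW.
have wp : 0 < `|adjoint A w| by rewrite normr_gt0.
rewrite -(ler_pM2l wp) -expr2 -inner_norm -(adjointP bA).
apply: le_trans (inner_le _ _) _.
by rewrite mulrA; apply: ler_wpM2r => //; rewrite mulrC.
Qed.

(** * Inverses of positive definite operators *)

Section PosDefinite.
Context {R : realType} {H : hilbertType R}.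
Implicit Types Q : H -> H.

(** If [c <= Q] and [|Q| <= C], then
    [|x - t Q x|^2 <= (1 - 2 t c + t^2 C^2) |x|^2], and [t = c / C^2] minimizes
    the factor.  This contraction yields both the inverse and the square
    root. *)
Lemma pos_definite_damping Q : pos_definite Q ->
  exists t r : R, [/\ 0 < t, 0 <= r < 1 & forall x, `|x - t *: Q x| <= r * `|x|].
Proof.
move=> [bQ _ [c c0 hc]]; have [C [C0 cC hC]] := bounded_operator_bound c bQ.
exists (c / C ^+ 2), (Num.sqrt (1 - c ^+ 2 / C ^+ 2)).
have C2 : 0 < C ^+ 2 by rewrite exprn_gt0.
have q0 : 0 < c ^+ 2 / C ^+ 2 by rewrite divr_gt0 ?exprn_gt0.
have q1 : c ^+ 2 / C ^+ 2 < 1.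
  by rewrite ltr_pdivrMr // mul1r ltr_pXn2r // nnegrE ltW.
split; first by rewrite divr_gt0.
  by rewrite sqrtr_ge0 -[ltRHS]sqrtr1 ltr_sqrt //; lra.
move=> x; rewrite -(@ler_pXn2r _ 2) ?nnegrE ?mulr_ge0 ?sqrtr_ge0 // exprMn.
rewrite sqr_sqrtr; last by lra.
rewrite -!inner_norm !innerE (innerC (Q x) x) (inner_norm (Q x)).
have h1 : `|Q x| ^+ 2 <= C ^+ 2 * inner x x.
  by rewrite inner_norm -exprMn ler_pXn2r ?nnegrE ?mulr_ge0 // ltW.
have h2 := hc x; rewrite -inner_norm in h2.
have t0 : 0 <= c / C ^+ 2 by rewrite divr_ge0 // ltW.
have t20 : 0 <= (c / C ^+ 2) ^+ 2 by exact: sqr_ge0.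
have := ler_wpM2l t0 h2; have := ler_wpM2l t20 h1.
have -> : (c / C ^+ 2) ^+ 2 * (C ^+ 2 * inner x x) = c ^+ 2 / C ^+ 2 * inner x x.
  by field; rewrite gt_eqF.
have -> : c / C ^+ 2 * (c * inner x x) = c ^+ 2 / C ^+ 2 * inner x x by ring.
lra.
Qed.

(** [Q x = y] is solved by the fixed point of the contraction
    [x |-> x - t Q x + t y]. *)
Lemma op_invK Q : pos_definite Q -> cancel (op_inv Q) Q.
Proof.
move=> pQ y; have [bQ _ _] := pQ.
have [t [r [t0 r01 hr]]] := pos_definite_damping pQ.
suff /getPex : exists x, Q x = y by [].
pose F x := x - t *: Q x + t *: y; pose u n := iter n F 0.
have FB a b : F a - F b = (a - b) - t *: Q (a - b).
  by rewrite /F opprD addrACA subrr addr0 opprD addrACA -opprD -scalerBr -(linB bQ.1).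
have ustep n : `|u n.+1 - u n| <= `|u 1%N - u 0%N| * r ^+ n.
  have r0 : 0 <= r by case/andP: r01.
  elim: n => [|n IH]; first by rewrite expr0 mulr1.
  rewrite exprS mulrCA; apply: le_trans (ler_wpM2l r0 IH).
  by rewrite [u n.+2]/(F (u n.+1)) {2}[u n.+1]/(F (u n)) FB.
have [x ux] := geometric_steps_cvg r01 ustep.
exists x; apply: (seq_cvg_unique (bounded_operator_cvg bQ ux)).
apply: (cvg_of_norm_le (e := fun n => (t^-1 * `|u 1%N - u 0%N|) * r ^+ n)).
  move=> n /=; rewrite -mulrA; apply: le_trans (ler_wpM2l _ (ustep n)).
    rewrite [u n.+1]/(F (u n)) /F addrAC (addrAC (u n)) subrr add0r addrC.
    by rewrite -scalerBr normrZ gtr0_norm // mulKf ?gt_eqF // distrC.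
  by rewrite invr_ge0 ltW.
exact: geometric_cvg0.
Qed.

Lemma pos_definite_inj Q : pos_definite Q -> injective Q.
Proof.
move=> [bQ _ [c c0 hc]] x y xy; apply/eqP; rewrite -subr_eq0 -normr_eq0 -sqrf_eq0.
rewrite -(mulrI_eq0 _ (lregP (lt0r_neq0 c0))) eq_le mulr_ge0 ?(ltW c0) ?sqr_ge0 //.
by rewrite andbT; apply: le_trans (hc _) _; rewrite (linB bQ.1) xy subrr innerC inner0l.
Qed.

Lemma op_invKV Q : pos_definite Q -> cancel Q (op_inv Q).
Proof. by move=> pQ x; apply: (pos_definite_inj pQ); rewrite op_invK. Qed.

Lemma pos_definite_ge0 Q : pos_definite Q -> forall x, 0 <= inner x (Q x).
Proof.
move=> [_ _ [c c0 hc]] x; apply: le_trans (hc x).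
by rewrite mulr_ge0 ?sqr_ge0 // ltW.
Qed.

Lemma pos_definite_inv Q : pos_definite Q -> pos_definite (op_inv Q).
Proof.
move=> pQ; have [bQ sQ [c c0 hc]] := pQ.
have QK := op_invK pQ.
have [C [C0 _ hC]] := bounded_operator_bound 0 bQ.
split.
- split; first by move=> a x y; apply: (pos_definite_inj pQ); rewrite bQ.1 !QK.
  exists c^-1 => y; set x := op_inv Q y; have -> : y = Q x by rewrite QK.
  rewrite ler_pdivlMl //; have [->|x0] := eqVneq x 0.
    by rewrite normr0 mulr0.
  have xp : 0 < `|x| by rewrite normr_gt0.
  rewrite -(ler_pM2l xp) mulrCA -expr2; apply: le_trans (hc x) (inner_le _ _).
- by move=> x y; rewrite -{2}(QK x) sQ QK.
- exists (c / C ^+ 2); first by rewrite divr_gt0 ?exprn_gt0.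
  move=> y; set x := op_inv Q y; have -> : y = Q x by rewrite QK.
  rewrite innerC; apply: le_trans (hc x).
  rewrite -mulrA ler_pM2l // ler_pdivrMl ?exprn_gt0 // -exprMn.
  by rewrite ler_pXn2r ?nnegrE // mulr_ge0 // ltW.
Qed.

End PosDefinite.

(** * Square roots of positive definite operators *)

Section SquareRoot.
Context {R : realType} {H : hilbertType R}.
Implicit Types (B Q : H -> H) (x y : H).

Section Iterates.
Variables (B : H -> H) (r : R).
Hypotheses (r01 : 0 <= r < 1) (linB' : linear B) (sB : self_adjoint B).
Hypothesis hB : forall x, `|B x| <= r * `|x|.

(** The iterates of [Y |-> (B + Y^2) / 2] from [0].  A fixed point [Y] satisfies
    [(1 - Y)^2 = 1 - B]. *)
Fixpoint sqrt_iter n x : H :=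
  if n is m.+1 then (1 / 2) *: (B x + sqrt_iter m (sqrt_iter m x)) else 0.

Let r0 : 0 <= r. Proof. by case/andP: r01. Qed.

Lemma linear_sqrt_iter n : linear (sqrt_iter n).
Proof.
elim: n => [|n IH] a x y /=; first by rewrite scaler0 addr0.
by rewrite linB' !IH; apply: eq_innerr => z; rewrite !innerE; ring.
Qed.

Lemma self_adjoint_sqrt_iter n : self_adjoint (sqrt_iter n).
Proof.
elim: n => [|n IH] x y /=; first by rewrite inner0l innerC inner0l.
by rewrite !innerE sB !IH.
Qed.

(** The ball of radius [r] is stable because [(r + r^2) / 2 <= r]. *)
Lemma sqrt_iter_le n x : `|sqrt_iter n x| <= r * `|x|.
Proof.
elim: n x => [|n IH] x /=; first by rewrite normr0 mulr_ge0.
rewrite normrZ ger0_norm; last by lra.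
have h1 := ler_normD (B x) (sqrt_iter n (sqrt_iter n x)).
have h2 := IH (sqrt_iter n x); have h3 := ler_wpM2l r0 (IH x).
have h4 : r * (r * `|x|) <= 1 * (r * `|x|).
  by apply: ler_wpM2r; [rewrite mulr_ge0 | case/andP: r01 => _ /ltW].
have := hB x; lra.
Qed.

(** From [Y'^2 - Y^2 = Y' (Y' - Y) + (Y' - Y) Y], which does not use that the
    iterates commute, the map is [r]-Lipschitz on the ball of radius [r]. *)
Lemma sqrt_iter_step n x :
  `|sqrt_iter n.+1 x - sqrt_iter n x| <= r * `|x| * r ^+ n.
Proof.
elim: n x => [|n IH] x.
  by rewrite subr0 expr0 mulr1; exact: (sqrt_iter_le 1).
have -> : sqrt_iter n.+2 x - sqrt_iter n.+1 x = (1 / 2) *: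
    (sqrt_iter n.+1 (sqrt_iter n.+1 x - sqrt_iter n x)
     + (sqrt_iter n.+1 (sqrt_iter n x) - sqrt_iter n (sqrt_iter n x))).
  rewrite (linB (linear_sqrt_iter n.+1)).
  rewrite {1}/sqrt_iter -/(sqrt_iter n.+1) {3}/sqrt_iter -/(sqrt_iter n).
  by apply: eq_innerr => z; rewrite !innerE; ring.
rewrite normrZ ger0_norm; last by lra.
set u := sqrt_iter n.+1 _; set v := _ - sqrt_iter n (sqrt_iter n x).
have h1 := ler_normD u v.
have h2 : `|u| <= r * (r * `|x| * r ^+ n).
  exact: le_trans (sqrt_iter_le _ _) (ler_wpM2l r0 (IH x)).
have h3 : `|v| <= r * (r * `|x|) * r ^+ n.
  apply: le_trans (IH _) _; apply: ler_wpM2r; first by rewrite exprn_ge0.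
  by apply: ler_wpM2l => //; exact: sqrt_iter_le.
rewrite exprS; lra.
Qed.

(** The iterates converge pointwise with rate [r ^+ n], so no topology on the
    operators is involved; linearity, symmetry and the bound pass to the
    limit. *)
Lemma sqrt_fixpoint : exists Y : H -> H,
  [/\ linear Y, self_adjoint Y, forall x, `|Y x| <= r * `|x| &
      forall x, Y x = (1 / 2) *: (B x + Y (Y x))].
Proof.
have /choice [Y hY] x : exists y : H, (sqrt_iter ^~ x) @ \oo --> y.
  by apply: (geometric_steps_cvg r01) => n; exact: sqrt_iter_step.
have Yle x : `|Y x| <= r * `|x|.
  apply: (ler_cvg_to (cvg_norm (hY x)) (cvg_cst (r * `|x|))).
  by apply: nearW => n; exact: sqrt_iter_le.
have linY : linear Y.
  move=> a x y; apply: (seq_cvg_unique (hY _)).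
  rewrite [X in X @ _ --> _](_ : _ =
    fun n => a *: sqrt_iter n x + sqrt_iter n y).
    by apply: cvgD => //; apply: cvgZl_tmp.
  by apply/funext => n; exact: linear_sqrt_iter.
exists Y; split => // [x y|x].
  apply: (seq_cvg_unique (V := R^o) (inner_cvgl (hY x))).
  rewrite innerC [X in X @ _ --> _](_ : _ =
    fun n => inner (sqrt_iter n y) x); first exact: inner_cvgl.
  by apply/funext => n; rewrite self_adjoint_sqrt_iter innerC.
(* [Y_n (Y_n x)] tends to [Y (Y x)] because the [Y_n] share the Lipschitz
   constant [r] *)
have hYS := hY x; rewrite -cvg_shiftS in hYS.
apply: (seq_cvg_unique hYS); rewrite /=.
apply: cvgZl_tmp; apply: cvgD; first exact: cvg_cst.
apply: (cvg_of_norm_le (e := fun n =>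
  r * `|sqrt_iter n x - Y x| + `|sqrt_iter n (Y x) - Y (Y x)|)).
  move=> n; rewrite -(subrKA (sqrt_iter n (Y x))).
  apply: le_trans (ler_normD _ _) _; apply: lerD => //.
  by rewrite -(linB (linear_sqrt_iter n)) sqrt_iter_le.
have d0 y : (fun n => `|sqrt_iter n y - Y y|) @ \oo --> (0 : R).
  by apply/norm_cvg0P/subr_cvg0.
rewrite -[X in _ --> X](addr0 0) -{1}(mulr0 r).
by apply: cvgD => //; apply: cvgMl_tmp.
Qed.

End Iterates.

(** For [B = 1 - t Q] a contraction, [1 - Y] is a square root of [t Q], positive
    because [|Y| <= r < 1]; it remains to divide it by the square root of
    [t]. *)
Lemma pos_definite_sqrt Q : pos_definite Q ->
  exists W, pos_semidefinite W /\ W \o W = Q.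
Proof.
move=> pQ; have [bQ sQ _] := pQ.
have [t [r [t0 r01 hr]]] := pos_definite_damping pQ.
have [||Y [linY sY hY Yfix]] := sqrt_fixpoint (B := fun x => x - t *: Q x) r01 _ _ hr.
- by move=> a x y /=; rewrite bQ.1; apply: eq_innerr => z; rewrite !innerE; ring.
- by move=> x y; rewrite !innerE sQ.
set s := (Num.sqrt t)^-1.
have s0 : 0 <= s by rewrite invr_ge0 sqrtr_ge0.
have s2 : s * s * t = 1.
  rewrite -invfM -expr2 sqr_sqrtr ?ltW // mulVf ?gt_eqF //.
exists (fun x => s *: (x - Y x)); split; first split.
- split.
    by move=> a x y; rewrite linY; apply: eq_innerr => z; rewrite !innerE; ring.
  exists (s * (1 + r)) => x; rewrite normrZ ger0_norm // -mulrA.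
  apply: ler_wpM2l => //; apply: le_trans (ler_normB _ _) _.
  by rewrite mulrDl mul1r lerD2l.
- by move=> x y; rewrite !innerE sY.
- move=> x; rewrite !innerE inner_norm mulr_ge0 //.
  have h1 := inner_le x (Y x); have h2 := ler_wpM2l (normr_ge0 x) (hY x).
  have h3 : r * `|x| ^+ 2 <= 1 * `|x| ^+ 2.
    by apply: ler_wpM2r; [exact: sqr_ge0 | case/andP: r01 => _ /ltW].
  by move: h1 h2 h3; lra.
apply/funext => x /=; apply: eq_innerr => z.
rewrite (linZ linY) (linB linY) !innerE.
have := congr1 (inner z) (Yfix x); rewrite !innerE => h.
have -> : inner z (Y (Y x)) = 2 * inner z (Y x) - (inner z x - t * inner z (Q x)).
  by lra.
by transitivity (s * s * t * inner z (Q x)); [ring | rewrite s2 mul1r].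
Qed.

Lemma op_sqrtP Q : pos_definite Q ->
  pos_semidefinite (op_sqrt Q) /\ op_sqrt Q \o op_sqrt Q = Q.
Proof. by move=> /pos_definite_sqrt/getPex. Qed.

End SquareRoot.

(** * Operator norm and comparison of quadratic forms *)

Lemma op_norm_le {R : realType} {V W : normedModType R} (T : V -> W) (x : V) :
  bounded_operator T -> `|T x| <= op_norm T * `|x|.
Proof.
move=> bT; have [C [C0 _ hC]] := bounded_operator_bound 0 bT.
have [->|x0] := eqVneq x 0; first by rewrite (lin0 bT.1) !normr0 mulr0.
have xp : 0 < `|x| by rewrite normr_gt0.
rewrite -ler_pdivrMr // mulrC -[X in X * _]gtr0_norm ?invr_gt0 // -normrZ.
rewrite -(linZ bT.1); apply: ub_le_sup.
  exists C => _ [y /= y1 <-]; apply: le_trans (hC y) _.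
  by rewrite -[leRHS]mulr1 ler_pM2l.
by exists (`|x|^-1 *: x) => //=; rewrite normrZ normfV normr_id mulVf ?gt_eqF.
Qed.

Lemma op_norm_ge0 {R : realType} {V W : normedModType R} (T : V -> W) :
  bounded_operator T -> 0 <= op_norm T.
Proof.
move=> bT; have [C [C0 _ hC]] := bounded_operator_bound 0 bT.
apply: ub_le_sup; last by exists 0; rewrite /= ?(lin0 bT.1) normr0.
exists C => _ [y /= y1 <-]; apply: le_trans (hC y) _.
by rewrite -[leRHS]mulr1 ler_pM2l.
Qed.

Lemma bounded_operator_comp {R : realType} {U V W : normedModType R}
    (T : V -> W) (T' : U -> V) :
  bounded_operator T -> bounded_operator T' -> bounded_operator (T \o T').
Proof.
move=> bT bT'; have [C [C0 _ hC]] := bounded_operator_bound 0 bT.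
have [linT' [C' hC']] := bT'; split.
  by move=> a x y /=; rewrite linT' bT.1.
exists (C * C') => x /=; apply: le_trans (hC _) _.
by rewrite -mulrA ler_pM2l.
Qed.

Lemma bounded_operator_scale {R : realType} {V W : normedModType R}
    (a : R) (T : V -> W) :
  bounded_operator T -> bounded_operator (fun x => a *: T x).
Proof.
move=> [linT [C hC]]; split.
  by move=> b x y; rewrite linT scalerDr !scalerA mulrC.
by exists (`|a| * C) => x; rewrite normrZ -mulrA ler_wpM2l.
Qed.

(** [W] is a square root of [Q^-1], so [x = W u] with [u = W (Q x)], whence
    [<x, M x> = <u, W M W u>] and [<x, Q x> = |u|^2]. *)
Lemma quadratic_form_le {R : realType} {H : hilbertType R} (Q M W : H -> H) :
  pos_definite Q -> bounded_operator M ->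
  pos_semidefinite W -> W \o W = op_inv Q ->
  forall x, inner x (M x) <= op_norm (W \o M \o W) * inner x (Q x).
Proof.
move=> pQ bM [bW sW _] WW x.
have bT : bounded_operator (W \o M \o W).
  by apply: bounded_operator_comp => //; exact: bounded_operator_comp.
have WWQ : W (W (Q x)) = x.
  by have := congr1 (@^~ (Q x)) WW; rewrite /= op_invKV.
set u := W (Q x).
have -> : inner x (M x) = inner u ((W \o M \o W) u).
  by rewrite /= -sW /u WWQ.
have -> : inner x (Q x) = `|u| ^+ 2 by rewrite -inner_norm sW WWQ innerC.
apply: le_trans (inner_le _ _) _.
rewrite expr2 mulrCA; apply: ler_wpM2l => //.
exact: op_norm_le.
Qed.

(** * The operator A P^-1 A^T *)

Section OpAPA.
Context {R : realType} {X S : hilbertType R}.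
Variables (A : X -> S) (P : X -> X).
Hypotheses (bA : bounded_operator A) (pP : pos_definite P).

Lemma inner_opAPA s t :
  inner s (opAPA A P t) = inner (adjoint A s) (op_inv P (adjoint A t)).
Proof. by rewrite innerC (adjointP bA) innerC. Qed.

Lemma opAPA_pos_semidefinite : pos_semidefinite (opAPA A P).
Proof.
have pI := pos_definite_inv pP; have [bI sI _] := pI; split.
- apply: bounded_operator_comp; last exact: bounded_adjoint.
  exact: bounded_operator_comp.
- by move=> s t; rewrite inner_opAPA innerC inner_opAPA -sI innerC.
- by move=> s; rewrite inner_opAPA; exact: pos_definite_ge0.
Qed.

End OpAPA.

(** * The estimates behind one step *)

Section Estimates.
Context {R : realType} {H : hilbertType R}.
Implicit Types (Q N : H -> H) (v w g : H) (tau beta mu theta : R).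

(** Expanding the square, the term [tau^2 |g|^2_(Q^-1)] is at most
    [tau^2 / beta <v, g>] by cocoercivity; what is left of [- 2 tau <v, g>] has
    the coefficient [- (2 tau - tau^2 / beta) <= 0], so that strong
    monotonicity applies. *)
Lemma forward_step_le Q v g tau beta mu : pos_definite Q ->
  0 <= tau <= 2 * beta -> 0 < beta ->
  beta * sqnorm (op_inv Q) g <= inner v g -> mu * sqnorm Q v <= inner v g ->
  sqnorm Q (v - tau *: op_inv Q g)
    <= (1 - (2 * tau - tau ^+ 2 / beta) * mu) * sqnorm Q v.
Proof.
move=> pQ /andP[tau0 tb] b0 hb hm; have [[linQ _] sQ _] := pQ.
have c0 : 0 <= 2 * tau - tau ^+ 2 / beta.
  have -> : 2 * tau - tau ^+ 2 / beta = tau * (2 * beta - tau) / beta.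
    by field; rewrite gt_eqF.
  by rewrite divr_ge0 ?(ltW b0) // mulr_ge0 // subr_ge0.
have -> : sqnorm Q (v - tau *: op_inv Q g) =
    sqnorm Q v - 2 * tau * inner v g + tau ^+ 2 * sqnorm (op_inv Q) g.
  rewrite /sqnorm (linB linQ) (linZ linQ) (op_invK pQ) !innerE.
  by rewrite -(sQ (op_inv Q g)) (op_invK pQ) (innerC g v) (innerC (op_inv Q g) g); ring.
have h1 := ler_wpM2l c0 hm.
have t2 : 0 <= tau ^+ 2 / beta by rewrite divr_ge0 ?sqr_ge0 // ltW.
have := ler_wpM2l t2 hb; rewrite mulrA divfK ?gt_eqF //; lra.
Qed.

(** With [a = v - tau Q^-1 q], the left side is [2 <Q (a - w), w>], and the
    difference of the two sides is the square [|w - a|^2_Q]. *)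
Lemma dual_forward_backward_le Q v w q tau : pos_definite Q ->
  2 * inner (Q (v - w)) w - 2 * tau * inner q w
    <= sqnorm Q (v - tau *: op_inv Q q) - sqnorm Q w.
Proof.
move=> pQ; have [[linQ _] sQ _] := pQ.
have := pos_definite_ge0 pQ (w - (v - tau *: op_inv Q q)).
rewrite (linB linQ w); set a := v - _.
have -> : inner q w = inner (op_inv Q q) (Q w) by rewrite -sQ op_invK.
rewrite /sqnorm sQ !innerE (innerC w (Q a)) sQ.
have -> : inner a (Q w) = inner v (Q w) - tau * inner (op_inv Q q) (Q w).
  by rewrite /a !innerE.
lra.
Qed.

(** The difference of the two sides is
    [(1 - theta) |v + w|^2_N + (4 theta - 3) |w|^2_N], hence the threshold
    [3 / 4]. *)
Lemma indefinite_part_le N v w theta : pos_semidefinite N ->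
  3 / 4 <= theta <= 1 ->
  2 * (1 - theta) * inner (N (w - v)) w - sqnorm N w
    <= (1 - theta) * (sqnorm N v - sqnorm N w).
Proof.
move=> [[linN _] sN N0] /andP[t34 t1].
have h0 := N0 w; have := N0 (v + w).
rewrite /sqnorm (linB linN) (linD linN) !innerE !sN (innerC w (N v)) sN.
have t0 : 0 <= 1 - theta by lra.
move=> /(mulr_ge0 t0).
have t4 : 0 <= 4 * theta - 3 by lra.
by have := mulr_ge0 t4 h0; lra.
Qed.

End Estimates.

(** For [a <= b] the quotient [(a m1 + m2) / (b m1 + m2)] increases with
    [m2 / m1], whose largest value is [C]. *)
Lemma mediant_le {R : realFieldType} (a b C m1 m2 : R) :
  a <= b -> 0 < b -> 0 <= C -> m2 <= C * m1 ->
  a * m1 + m2 <= (a + C) / (b + C) * (b * m1 + m2).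
Proof.
move=> ab b0 C0 m21; have bC : 0 < b + C by lra.
rewrite mulrAC ler_pdivlMr //.
have := mulr_ge0 (_ : 0 <= b - a) (_ : 0 <= C * m1 - m2).
rewrite !subr_ge0 => /(_ ab m21); lra.
Qed.

(** * One step of the iteration *)

Section Step.
Context {R : realType} {X S : hilbertType R}.
Variables (f : X -> \bar R) (h l : S -> \bar R).
Variables (A : X -> S) (P : X -> X) (D : S -> S) (tau sigma theta : R).
Hypotheses (bA : bounded_operator A) (pP : pos_definite P).
Hypotheses (tau0 : 0 < tau) (sigma0 : 0 < sigma).

Let M1 := opM1 P D A tau sigma theta.
Let M2 := opM2 P A tau theta.

Lemma opM_split s : opM P D A tau sigma s = M1 s - M2 s.
Proof.
apply: eq_innerr => z; rewrite /M1 /M2 /opM /opM1 /opM2 !innerE.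
by field; rewrite gt_eqF.
Qed.

Lemma bounded_opM2 : bounded_operator M2.
Proof.
apply: bounded_operator_scale.
by have [] := opAPA_pos_semidefinite bA pP.
Qed.

(** The formula for [x'] gives
    [A (x - tau P^-1 grad f x) = A x' + tau A P^-1 A^T s'].  Substituted in the
    resolvent equation, the last term turns [D s'] into
    [(sigma / tau) M s']. *)
Lemma dual_inclusion x s x' s' :
  iter_step f h l P D A tau sigma (x, s) (x', s') ->
  exists2 p, subdifferential (conjugate h) s' p &
    opM P D A tau sigma s' - opM P D A tau sigma s
      + tau *: (p + gradient (conjugate l) s) = tau *: A x'.
Proof.
case=> -[p hp Ds'] ->; exists p => //; have linA := bA.1.
rewrite (linB linA _ (tau *: _)) (linZ linA) -/(opAPA A P s').
move: Ds'; set b := A _; set m := opM _ _ _ _ _ s; set q := gradient _ _ => Ds'.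
apply: eq_innerr => z; have := congr1 (inner z) Ds'; rewrite /opM !innerE.
move=> /(canRL (addrK _)) ->.
by field; rewrite !gt_eqF.
Qed.

(** The scalar heart of the proof: the two relations between the increments
    give an identity for [|dx'|^2_P], in which every remaining term is bounded
    by one of the estimates above.  Gradients and subgradients enter only
    through the increments [g], [p], [q]. *)
Lemma increment_descent (beta mu_f mu_h mu_l : R) (dx dx' g : X)
    (v w p q : S) :
  pos_definite M1 -> 3 / 4 <= theta <= 1 -> 0 < beta -> tau <= 2 * beta ->
  beta * sqnorm (op_inv P) g <= inner dx g ->
  mu_f * sqnorm P dx <= inner dx g ->
  beta * sqnorm (op_inv M1) q <= inner v q ->
  mu_l * sqnorm M1 v <= inner v q ->
  mu_h * sqnorm M1 w <= inner w p ->
  dx - tau *: op_inv P g = dx' + tau *: op_inv P (adjoint A w) ->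
  M1 (w - v) - M2 (w - v) + tau *: (p + q) = tau *: A dx' ->
  sqnorm P dx' + ((1 + 2 * tau * mu_h) * sqnorm M1 w + sqnorm M2 w)
  <= (1 - (2 * tau - tau ^+ 2 / beta) * mu_f) * sqnorm P dx
     + ((1 - (2 * tau - tau ^+ 2 / beta) * mu_l) * sqnorm M1 v + sqnorm M2 v).
Proof.
move=> pM1 t34 b0 tb hg hmf hq hml hmh primalE dualE.
have [[linP _] sP _] := pP; have [[linM1 _] sM1 _] := pM1.
have psN := opAPA_pos_semidefinite bA pP.
have tau2b : 0 <= tau <= 2 * beta by rewrite tb ltW.
have := forward_step_le pP tau2b b0 hg hmf.
have := forward_step_le pM1 tau2b b0 hq hml.
have := dual_forward_backward_le v w q tau pM1.
have := ler_wpM2l (sqr_ge0 tau) (indefinite_part_le v w psN t34).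
have couple : tau * inner dx' (adjoint A w) =
    inner (M1 (w - v)) w - inner (M2 (w - v)) w
    + tau * inner w p + tau * inner q w.
  rewrite -(adjointP bA) -innerZl -dualE.
  move: (M1 _) (M2 _) => a b.
  by rewrite !innerE (innerC w p); ring.
have primal : sqnorm P dx' + 2 * (tau * inner dx' (adjoint A w))
    + tau ^+ 2 * sqnorm (opAPA A P) w = sqnorm P (dx - tau *: op_inv P g).
  rewrite primalE /sqnorm inner_opAPA // (linD linP) (linZ linP).
  rewrite (op_invK pP) !innerE -(sP (op_inv P _)) (op_invK pP).
  rewrite (innerC (op_inv P _)) (innerC (adjoint A w) dx').
  by move: (inner dx' _) (inner dx' _) (inner (adjoint A w) _) => *; ring.
have tau_hmh : tau * (mu_h * sqnorm M1 w) <= tau * inner w p.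
  by rewrite ler_pM2l.
have M2E u : sqnorm M2 u = tau ^+ 2 * (1 - theta) * sqnorm (opAPA A P) u.
  by rewrite /sqnorm /M2 /opM2 innerZr.
have -> : tau ^+ 2 * (2 * (1 - theta) * inner (opAPA A P (w - v)) w
    - sqnorm (opAPA A P) w)
    = 2 * inner (M2 (w - v)) w - tau ^+ 2 * sqnorm (opAPA A P) w.
  by rewrite /M2 /opM2 innerZl; move: (inner _ _) (sqnorm _ _) => *; ring.
have -> : tau ^+ 2 * ((1 - theta) * (sqnorm (opAPA A P) v - sqnorm (opAPA A P) w))
    = sqnorm M2 v - sqnorm M2 w.
  by rewrite !M2E; move: (sqnorm _ _) (sqnorm _ _) => *; ring.
rewrite -(opprB w v) (linN linM1) innerNl.
move: couple primal tau_hmh; clear.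
(* all that follows is linear in the quadratic expressions *)
move: (_ * sqnorm P dx) (_ * sqnorm M1 v) (sqnorm P dx') (sqnorm P (dx - _)).
move: (sqnorm M1 (v - _)) (tau ^+ 2 * sqnorm (opAPA A P) w) (inner q w).
move: (inner dx' _) (inner (M1 _) w) (inner (M2 _) w) (inner w p).
by move: (sqnorm M1 w) (sqnorm M2 w) (sqnorm M2 v) => *; lra.
Qed.

(** A fixed point is a step from itself to itself, so both relations are
    differences of the equations of two steps. *)
Lemma step_increments x s x' s' xs ss :
  linear M1 ->
  iter_step f h l P D A tau sigma (x, s) (x', s') ->
  fixed_point f h l P D A tau sigma (xs, ss) ->
  let g := gradient f x - gradient f xs in
  let q := gradient (conjugate l) s - gradient (conjugate l) ss in
  let v := s - ss in let w := s' - ss in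
  exists p ps : S,
  [/\ subdifferential (conjugate h) s' p, subdifferential (conjugate h) ss ps,
    (x - xs) - tau *: op_inv P g
      = (x' - xs) + tau *: op_inv P (adjoint A w) &
    M1 (w - v) - M2 (w - v) + tau *: (p - ps + q) = tau *: A (x' - xs)].
Proof.
move=> linM1 step fix_s g q v w.
have [p hp ps_eq] := dual_inclusion step.
have [ps hps pss_eq] := dual_inclusion fix_s.
have {step} [_ x'E] := step; have {fix_s} [_ xsE] := fix_s.
have [[linI _] _ _] := pos_definite_inv pP.
have [linT _] := bounded_adjoint bA.
have [linM2 _] := bounded_opM2.
exists p, ps; split=> //.
  rewrite x'E [X in _ = _ - X + _]xsE /g /w (linB linT) !(linB linI).
  move: (op_inv P (gradient f x)) (op_inv P (gradient f xs)) => a b.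
  move: (op_inv P _) (op_inv P _) => c d.
  by apply: eq_innerr => y; rewrite !innerE; ring.
have -> : w - v = s' - s by rewrite /w /v opprB addrA subrK.
rewrite (linB bA.1) scalerBr -ps_eq -pss_eq !opM_split.
rewrite (linB linM1) (linB linM2) /q.
move: (M1 s') (M1 s) (M2 s') (M2 s) => a b c d.
move: (gradient _ _) (gradient _ _) (M1 ss - M2 ss) => *.
by apply: eq_innerr => y; rewrite !innerE; ring.
Qed.

End Step.

(** * Linear convergence *)

Lemma sqr_geometric_cvg {R : realType} {V : normedModType R} (u : nat -> V)
    (a : V) (K r : R) : 0 <= K -> 0 <= r < 1 ->
  (forall n, `|u n - a| ^+ 2 <= K * r ^+ n) -> u @ \oo --> a.
Proof.
move=> K0 /andP[r0 r1] hu.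
apply: (cvg_of_norm_le (e := fun n => Num.sqrt K * Num.sqrt r ^+ n)).
  move=> n; rewrite -(@ler_pXn2r _ 2) ?nnegrE ?mulr_ge0 ?exprn_ge0 ?sqrtr_ge0 //.
  by rewrite exprMn exprAC !sqr_sqrtr.
apply: geometric_cvg0; rewrite sqrtr_ge0 /=.
by rewrite -[ltRHS]sqrtr1 ltr_sqrt.
Qed.

Unset Implicit Arguments.
Set Strict Implicit.

Theorem theorem3 (R : realType) (X S : hilbertType R)
    (f : X -> \bar R) (h l : S -> \bar R)
    (A : X -> S) (P : X -> X) (D : S -> S) (tau sigma theta : R)
    (hA : bounded_operator A)
    (hP : pos_definite P)
    (hDb : bounded_operator D) (hDs : self_adjoint D)
    (htau : 0 < tau) (hsigma : 0 < sigma) (htheta : 3 / 4 < theta <= 1)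
    (hf : proper_lsc_convex f) (hh : proper_lsc_convex h)
    (hl : proper_lsc_convex l)
    (hfd : frechet_differentiable f)
    (hld : frechet_differentiable (conjugate l)) :
  let M1 := opM1 P D A tau sigma theta in
  let M2 := opM2 P A tau theta in
  let fixpt := fixed_point f h l P D A tau sigma in
  let grad_f := gradient f in
  let grad_lc := gradient (conjugate l) in
  let sub_hc := subdifferential (conjugate h) in
  pos_definite M1 ->
  (exists z, fixpt z) ->
  forall beta mu_f mu_h mu_l : R,
  0 < beta -> 0 <= mu_f -> 0 <= mu_h -> 0 <= mu_l ->
  (forall (xs : X) (ss : S), fixpt (xs, ss) -> forall (x : X) (s : S),
     [/\ inner (x - xs) (grad_f x - grad_f xs)
           >= beta * sqnorm (op_inv P) (grad_f x - grad_f xs),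
         inner (s - ss) (grad_lc s - grad_lc ss)
           >= beta * sqnorm (op_inv M1) (grad_lc s - grad_lc ss),
         inner (x - xs) (grad_f x - grad_f xs) >= mu_f * sqnorm P (x - xs),
         (forall p ps : S, sub_hc s p -> sub_hc ss ps ->
            inner (s - ss) (p - ps) >= mu_h * sqnorm M1 (s - ss))
       & inner (s - ss) (grad_lc s - grad_lc ss) >= mu_l * sqnorm M1 (s - ss)]) ->
  forall (zs : X * S) (z : nat -> X * S),
  fixpt zs ->
  (forall k, iter_step f h l P D A tau sigma (z k) (z k.+1)) ->
  let Mhat := fun s : S => (1 + 2 * tau * mu_h) *: M1 s + M2 s in
  let M1_isqrt := op_sqrt (op_inv M1) in
  let C1 := op_norm (M1_isqrt \o M2 \o M1_isqrt) in
  let rho1 := Num.max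
    ((1 - (2 * tau - tau ^+ 2 / beta) * mu_l + C1) / (1 + 2 * tau * mu_h + C1))
    (1 - (2 * tau - tau ^+ 2 / beta) * mu_f) in
  let err := fun k => sqnorm_pair P Mhat (z k - zs) in
  (tau <= 2 * beta -> forall k, err k.+1 <= rho1 * err k) /\
  (0 < tau < 2 * beta -> 0 < mu_h + mu_l -> 0 < mu_f ->
     [/\ rho1 < 1, forall k, err k <= rho1 ^+ k * err 0%N
       & z @ \oo --> zs]).
Proof.
move=> M1 M2 fixpt grad_f grad_lc sub_hc pM1 _ beta mu_f mu_h mu_l b0 mf0 mh0 ml0.
move=> hmono [xs ss] z fix_s hz Mhat M1_isqrt C1 rho1 err.
have t34 : 3 / 4 <= theta <= 1 by case/andP: htheta => /ltW -> ->.
have [psW WW] := op_sqrtP (pos_definite_inv pM1).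
have bM2 : bounded_operator M2 by exact: bounded_opM2.
have [bW _ _] := psW; have [[linM1 _] _ _] := pM1.
have C0 : 0 <= C1.
  by apply: op_norm_ge0; apply: bounded_operator_comp => //;
     exact: bounded_operator_comp.
have M2C1 : forall s, sqnorm M2 s <= C1 * sqnorm M1 s.
  exact: quadratic_form_le pM1 bM2 psW WW.
have M1_ge0 s : 0 <= sqnorm M1 s by exact: pos_definite_ge0.
have P_ge0 x : 0 <= sqnorm P x by exact: pos_definite_ge0.
have M2_ge0 s : 0 <= sqnorm M2 s.
  have [_ _ N0] := opAPA_pos_semidefinite hA hP.
  rewrite /sqnorm /M2 /opM2 innerZr mulr_ge0 // mulr_ge0 ?sqr_ge0 //.
  by case/andP: htheta => _; rewrite subr_ge0.
have MhatE s : sqnorm Mhat s = (1 + 2 * tau * mu_h) * sqnorm M1 s + sqnorm M2 s.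
  by rewrite /sqnorm /Mhat innerDr innerZr.
have tmh0 : 0 <= 2 * tau * mu_h by rewrite !mulr_ge0 // ltW.
have Mhat_ge s : sqnorm M1 s <= sqnorm Mhat s.
  rewrite MhatE mulrDl mul1r -addrA lerDl addr_ge0 // mulr_ge0 //.
have errE k : err k = sqnorm P ((z k).1 - xs) + sqnorm Mhat ((z k).2 - ss) by [].
have err_ge0 k : 0 <= err k.
  by rewrite errE addr_ge0 // (le_trans (M1_ge0 _) (Mhat_ge _)).
have cE : 2 * tau - tau ^+ 2 / beta = tau * (2 * beta - tau) / beta.
  by field; rewrite gt_eqF.
set c := 2 * tau - tau ^+ 2 / beta in rho1 cE *.
have step_err : tau <= 2 * beta -> forall k, err k.+1 <= rho1 * err k.
  move=> tb k; rewrite !errE.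
  have c0 : 0 <= c by rewrite cE divr_ge0 ?(ltW b0) // mulr_ge0 ?subr_ge0 // ltW.
  case: (z k) (z k.+1) (hz k) => [x s] [x' s'] /= hk.
  have [hg hq hmf _ hml] := hmono _ _ fix_s x s.
  have [p [ps [hp hps primalE dualE]]] :=
    step_increments hA hP htau hsigma linM1 hk fix_s.
  have [_ _ _ hmh _] := hmono _ _ fix_s x' s'.
  have := increment_descent hA hP htau pM1 t34 b0 tb hg hmf hq hml (hmh _ _ hp hps) primalE dualE.
  rewrite -/c -MhatE => hd; apply: le_trans hd _.
  rewrite mulrDr; apply: lerD.
    by apply: ler_wpM2r => //; rewrite /rho1 le_max lexx orbT.
  have cml : 0 <= c * mu_l by rewrite mulr_ge0.
  apply: le_trans (mediant_le (b := 1 + 2 * tau * mu_h) _ _ C0 (M2C1 _)) _.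
  - by lra.
  - by lra.
  rewrite -MhatE; apply: ler_wpM2r; first exact: le_trans (M1_ge0 _) (Mhat_ge _).
  by rewrite /rho1 le_max lexx.
split=> // /andP[_ tb] mhl mf.
have {}step_err := step_err (ltW tb).
have c0 : 0 < c by rewrite cE divr_gt0 // mulr_gt0 // subr_gt0.
have rho_lt1 : rho1 < 1.
  rewrite /rho1 gt_max ltr_pdivrMr; last by lra.
  have cmf : 0 < c * mu_f by rewrite mulr_gt0.
  suff : 0 < c * mu_l + 2 * tau * mu_h by lra.
  have [mh|mh] := ltP 0 mu_h.
    by apply: ltr_wpDl; [rewrite mulr_ge0 // ltW | rewrite !mulr_gt0].
  by apply: ltr_pwDl => //; rewrite mulr_gt0 //; lra.
have err_geo r : 0 <= r -> rho1 <= r -> forall k, err k <= r ^+ k * err 0%N.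
  move=> r0 rr; elim=> [|k IH]; first by rewrite expr0 mul1r.
  apply: le_trans (step_err k) _; rewrite exprS -mulrA.
  by apply: le_trans (ler_wpM2r (err_ge0 k) rr) _; exact: ler_wpM2l.
split=> //.
  have [r0|r0] := leP 0 rho1; first exact: err_geo.
  (* a negative factor is possible only if all the errors vanish *)
  move=> k; have err0 j : err j = 0.
    apply/eqP; rewrite eq_le err_ge0 andbT.
    have := le_trans (err_ge0 j.+1) (step_err j).
    by rewrite nmulr_rge0.
  by rewrite !err0 mulr0.
(* a rate in [0, 1) even when [rho1] is negative *)
set r := Num.max rho1 0.
have r0 : 0 <= r by rewrite le_max lexx orbT.
have r01 : 0 <= r < 1 by rewrite r0 gt_max rho_lt1 ltr01.
have {}err_geo k : err k <= err 0%N * r ^+ k.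
  by rewrite mulrC; apply: err_geo; rewrite // le_max lexx.
have [_ _ [cP cP0 hcP]] := hP; have [_ _ [cM cM0 hcM]] := pM1.
have zE : z = fun k => ((z k).1, (z k).2) by apply/funext => k; case: (z k).
rewrite zE; apply: cvg_pair.
  apply: (sqr_geometric_cvg (K := err 0%N / cP) (r := r)) => //.
    by rewrite divr_ge0 // ltW.
  move=> k; rewrite mulrAC ler_pdivlMr // mulrC.
  apply: le_trans (hcP _) _; apply: le_trans (err_geo k).
  by rewrite errE lerDl (le_trans (M1_ge0 _) (Mhat_ge _)).
apply: (sqr_geometric_cvg (K := err 0%N / cM) (r := r)) => //.
  by rewrite divr_ge0 // ltW.
move=> k; rewrite mulrAC ler_pdivlMr // mulrC.
apply: le_trans (hcM _) _; apply: le_trans (err_geo k).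
by rewrite errE; apply: le_trans (Mhat_ge _) _; rewrite lerDr.
Qed.
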